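(* Let $X$ and $B$ be real Banach spaces. Assume that $f:X\rightarrow B$ is a $C^{1}$ mapping (continuously Fréchet differentiable), that $\eta:B\rightarrow \mathbb{R}_{+}$ is a $C^{1}$ functional, and that the following conditions hold: (c1) for $x\in B$, $\eta(x)=0$ if and only if $x=0$, and $\eta'(x)=0$ if and only if $x=0$; (c2) for every $y\in B$ the functional $\varphi:X\rightarrow\mathbb{R}$, $\varphi(x)=\eta(f(x)-y)$, satisfies the Palais–Smale condition; (c3) for every $x\in X$ the Fréchet derivative $f'(x)$ is surjective, i.e. $f'(x)X=B$, and there exists a constant $\alpha_x>0$ such that $\|f'(x)h\|\geq \alpha_x\|h\|$ for all $h\in X$; (c4) there exist positive constants $\alpha$, $c$, $M$ such that $\eta(x)\geq c\|x\|^{\alpha}$ for all $x\in B$ with $\|x\|\leq M$. Then $f$ is a diffeomorphism.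
   Context: A map $f:X\rightarrow B$ between Banach spaces is a diffeomorphism if it is a continuously Fréchet differentiable bijection whose inverse $f^{-1}:B\rightarrow X$ is also continuously Fréchet differentiable. A functional $J:X\rightarrow\mathbb{R}$ of class $C^1$ satisfies the Palais–Smale condition if every sequence $(u_n)$ in $X$ such that $(J(u_n))$ is bounded and $J'(u_n)\rightarrow 0$ has a convergent subsequence. *)

(* Defs.v *)
From HB Require Import structures.
From mathcomp Require Import all_boot all_order all_algebra.
From mathcomp Require Import all_classical all_reals all_analysis.
Set Implicit Arguments. Unset Strict Implicit. Unset Printing Implicit Defensive.
Import Order.TTheory GRing.Theory Num.Theory.
Import numFieldNormedType.Exports.
Local Open Scope ring_scope.
Local Open Scope classical_set_scope.

Definition C1 {R : realType} {V W : normedModType R} (f : V -> W) : Prop :=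
  (forall x, differentiable f x) /\
  (forall x (e : R), 0 < e -> exists2 d : R, 0 < d &
     forall x', `|x' - x| < d -> forall h, `|'d f x' h - 'd f x h| <= e * `|h|).

Definition dual_cvg0 {R : realType} {V : normedModType R}
  (J : V -> R) (u : nat -> V) : Prop :=
  forall e : R, 0 < e -> exists N : nat, forall n, (N <= n)%N ->
    forall h, `|'d J (u n) h| <= e * `|h|.

Definition palais_smale {R : realType} {V : normedModType R} (J : V -> R) : Prop :=
  forall u : nat -> V,
    (exists M : R, forall n, `|J (u n)| <= M) ->
    dual_cvg0 J u ->
    exists (phi : nat -> nat) (l : V),
      {homo phi : m n / (m < n)%N >-> (m < n)%N} /\ (u \o phi) @ \oo --> l.

Definition diffeomorphism {R : realType} {V W : normedModType R} (f : V -> W) : Prop :=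
  C1 f /\ exists g : W -> V, cancel f g /\ cancel g f /\ C1 g.

(* Main.v *)
Require Import Defs.
From HB Require Import structures.
From mathcomp Require Import all_boot all_order all_algebra.
From mathcomp Require Import all_classical all_reals all_analysis.
From mathcomp Require Import ring lra.
Import Order.TTheory GRing.Theory Num.Theory.
Import numFieldNormedType.Exports.
Local Open Scope ring_scope.
Local Open Scope classical_set_scope.

(** The map f is a proper local homeomorphism. Properness: if f(u_n) -> y then
    phi(u_n) -> 0 for phi = eta(f(.) - y) >= 0, so Ekeland's principle moves
    each u_n by at most sqrt(phi(u_n)) to a point v_n with phi'(v_n) -> 0; by
    Palais-Smale (v_n), hence (u_n), has a convergent subsequence. The local
    inverse theorem uses Ekeland's principle again: an almost minimum of
    |f - b| near x0 must be a solution of f = b, since f' is surjective with a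
    lower bound there.

    Properness makes the local inverses near the fibre over b live on one
    common ball around b, so the local section through 0 can be continued
    along every segment starting at f(0). These continuations agree near each
    point and give a continuous global section g. On any segment issued from 0
    the points with g(f(x)) = x form an open and closed set, hence g inverts f. *)

(** * Induction along the unit interval *)

(** Cousin's lemma: the additive relation [Q a b] stands for a property of the
    interval [a, b]. *)
Lemma cousin_unit_interval (R : realType) (Q : R -> R -> Prop) :
  (forall a b c, a <= b -> b <= c -> Q a b -> Q b c -> Q a c) ->
  (forall t, 0 <= t <= 1 -> exists2 e, 0 < e & forall s s',
     0 <= s -> s <= t -> t <= s' -> s' <= 1 -> t - e < s -> s' < t + e -> Q s s') ->
  Q 0 1.
Proof.
move=> Qtr Qloc.
pose S := [set t : R | 0 <= t <= 1 /\ Q 0 t].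
have S0 : S 0.
  split; first by lra.
  have [|e e0] := Qloc 0; first by lra.
  by apply; lra.
have ubS : ubound S 1 by move=> x [/andP[]].
have supS : has_sup S by split; [exists 0 | exists 1].
set t := sup S.
have t0 : 0 <= t by exact: (ub_le_sup (proj2 supS) S0).
have t1 : t <= 1 by apply: ge_sup => //; exists 0.
have [|e e0 He] := Qloc t; first by rewrite t0.
have [s [s01 Qs] ts] := sup_adherent e0 supS.
have st : s <= t by apply: (ub_le_sup (proj2 supS)); split.
(* The local clause at the supremum [t] bridges from [s], just below [t], to any [s'] just beyond
   it; for [t < 1] this contradicts the choice of [t]. *)
have ext s' : t <= s' -> s' <= 1 -> s' < t + e -> Q 0 s'.
  move=> ts' s'1 s'e; apply: (Qtr 0 s s') => //; try lra.
  by apply: He => //; lra.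
have [t1'|t1'] := leP 1 t; first by apply: ext; lra.
pose s' := Num.min 1 (t + e / 2).
have [s'1 s't s'e] : [/\ s' <= 1, t < s' & s' < t + e].
  by rewrite /s'; case: (leP 1 (t + e/2)) => ?; split; lra.
have : S s' by split; [lra | apply: ext; lra].
by move/(ub_le_sup (proj2 supS)); rewrite leNgt s't.
Qed.

(** The open-and-closed argument on [0, 1]: the relation [P s -> P s'] is additive, so Cousin's
    lemma chains the local implications. *)
Lemma locally_constant_unit_interval (R : realType) (P : R -> Prop) :
  (forall t, 0 <= t <= 1 -> exists2 e, 0 < e & forall s s',
     0 <= s <= 1 -> 0 <= s' <= 1 -> `|s - t| < e -> `|s' - t| < e -> P s -> P s') ->
  P 0 -> P 1.
Proof.
move=> Ploc; apply: (@cousin_unit_interval R (fun s s' => P s -> P s')).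
  by move=> a b c _ _ ab bc /ab.
move=> t t01; have [e e0 He] := Ploc t t01; exists e => // s s' *.
apply: (He s s') => //; try lra; rewrite ltr_norml; lra.
Qed.

(** * Ekeland's variational principle *)

Lemma cvg_seq_distP (R : realType) (V : normedModType R) (u : nat -> V) (l : V) :
  u @ \oo --> l <->
  forall e : R, 0 < e -> exists N : nat, forall n, (N <= n)%N -> `|u n - l| < e.
Proof.
split=> [/cvgrPdist_lt ul e /ul [N _ HN]|ul].
  by exists N => n /HN; rewrite distrC.
apply/cvgrPdist_lt => e /ul [N HN]; exists N => // n /= /HN.
by rewrite distrC.
Qed.

Lemma continuous_atP (R : realType) (V W : normedModType R) (f : V -> W) (x : V) :
  {for x, continuous f} <->
  forall e : R, 0 < e -> exists2 d : R, 0 < d &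
    forall y, `|y - x| < d -> `|f y - f x| < e.
Proof.
split=> [/cvgrPdist_lt fx e /fx /nbhs_normP [d d0 Hd]|fx].
  exists d => // y yx; rewrite distrC; apply: Hd.
  by rewrite /ball_/= distrC.
apply/cvgrPdist_lt => e /fx [d d0 Hd]; apply/nbhs_normP; exists d => // y.
by rewrite /ball_/= distrC => /Hd; rewrite distrC.
Qed.

Lemma cauchy_cvg_seq (R : realType) (V : completeNormedModType R) (u : nat -> V) :
  (forall e : R, 0 < e -> exists N : nat, forall n, (N <= n)%N -> `|u n - u N| < e) ->
  exists l : V, u @ \oo --> l.
Proof.
move=> uC; apply/cvg_ex/cauchy_cvgP/cauchy_exP => e /uC [N HN].
exists (u N); exists N => // n /= /HN.
by rewrite -ball_normE /= distrC.
Qed.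

(** Descend from [u] through points whose drop in [F] pays [k] times the distance travelled. Since
    [F] is bounded below, the total path is finite, and near-optimal choices leave no worthwhile
    move at the limit. *)
Lemma ekeland (R : realType) (X : completeNormedModType R) (F : X -> R)
    (k : R) (u : X) :
  continuous F -> (forall x, 0 <= F x) -> 0 < k ->
  exists v, F v + k * `|v - u| <= F u /\ forall w, F v <= F w + k * `|w - v|.
Proof.
move=> cF F0 k0.
(* This is Ekeland's order: [S x] collects the points reachable from [x] by a paid descent.
   Transitivity is the triangle inequality. *)
pose S x := [set w : X | F w + k * `|w - x| <= F x].
have Sxx x : S x x by rewrite /S/= subrr normr0 mulr0 addr0.
have Str x y z : S x y -> S y z -> S x z.
  rewrite /S/= => xy yz; have : `|z - x| <= `|z - y| + `|y - x|.
    by rewrite (le_trans _ (ler_normD _ _))// subrKA.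
  by move=> /(ler_wpM2l (ltW k0)); rewrite mulrDr; lra.
have hinf x : has_inf (F @` S x).
  by split; [exists (F x), x | exists 0 => _ [w _ <-]].
have step x (n : nat) : exists y, S x y /\ forall w, S x w -> F y <= F w + n.+1%:R^-1.
  have n0 : (0 : R) < n.+1%:R^-1 by rewrite invr_gt0.
  have [_ [y Sy <-] Hy] := inf_adherent n0 (hinf x).
  exists y; split=> // w Sw; apply/ltW/(lt_le_trans Hy); rewrite lerD2r.
  by apply: ge_inf; [exact: (hinf x).2 | exists w].
pose next x n := projT1 (cid (step x n)).
pose us := fix us n := if n is m.+1 then next (us m) m else u.
have usS n : S (us n) (us n.+1) by rewrite /= /next; case: cid => ? [].
have usF n w : S (us n) w -> F (us n.+1) <= F w + n.+1%:R^-1.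
  by rewrite /= /next; case: cid => ? [] ? H /=; exact: H.
have uSm n m : S (us n) (us (n + m)%N).
  by elim: m => [|m IH]; rewrite ?addn0// addnS; apply: Str IH (usS _).
have uSle n m : (n <= m)%N -> S (us n) (us m) by move=> /subnKC <-.
have Fdec : nonincreasing_seq (F \o us).
  move=> n m /uSle; rewrite /S /=; have := mulr_ge0 (ltW k0) (normr_ge0 (us m - us n)); lra.
have Fcvg : cvg (F \o us @ \oo).
  by apply: nonincreasing_is_cvgn => //; exists 0 => _ [n _ <-] /=.
(* Distances along the sequence are at most the drops of [F] divided by [k], and the values of [F]
   converge. *)
have [v uv] : exists v : X, us @ \oo --> v.
  apply: cauchy_cvg_seq => e e0.
  have ke0 : 0 < k * e / 2 by rewrite divr_gt0 ?mulr_gt0.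
  have /cvg_seq_distP /(_ _ ke0) [N HN] := Fcvg.
  exists N => n Nn; have := uSle _ _ Nn; rewrite /S/= => Snm.
  have := HN N (leqnn N); have := HN n Nn; rewrite /= !ltr_norml.
  by move=> h1 h2; rewrite -(ltr_pM2l k0); lra.
(* [S (us n)] is closed: were [v] outside by a gap [D], a late term [w] would lose less than [D / 2]
   in [F] and less than [D / 2] in [k] times the distance, so it would be outside too. *)
have SF n : S (us n) v.
  rewrite /S/= leNgt; apply/negP => lt.
  set D := F v + k * `|v - us n| - F (us n).
  have D0 : 0 < D by rewrite /D; lra.
  have /continuous_atP /(_ _ (divr_gt0 D0 (ltr0n _ 2))) [d d0 Hd] := cF v.
  have Dk0 : 0 < D / 2 / k by rewrite !divr_gt0.
  have /cvg_seq_distP/(_ (Num.min d (D / 2 / k))) := uv.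
  rewrite lt_min d0 Dk0 => /(_ isT) [N HN].
  have := HN (maxn N n) (leq_maxl _ _); rewrite lt_min => /andP[/Hd].
  rewrite ltr_norml => /andP[lt1 _]; rewrite ltr_pdivlMr // => lt2.
  have := uSle _ _ (leq_maxr N n); rewrite /S/=.
  set w := us (maxn N n) in lt1 lt2 *.
  have : `|v - us n| <= `|w - v| + `|w - us n|.
    by rewrite [`|w - v|]distrC (le_trans _ (ler_normD _ _))// subrKA.
  move=> /(ler_wpM2l (ltW k0)); rewrite mulrDr /D in lt1 lt2 *; lra.
exists v; split; first exact: (SF 0%N).
(* A better [w] would lie in every [S (us n)], so the almost-minimality of [us n.+1] puts [F v]
   within 1/(n+1) of [F w], which is less than the gap for large [n]. *)
move=> w; rewrite leNgt; apply/negP => lt.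
have Sw n : S (us n) w by apply: Str (SF n) _; exact: ltW.
have D0 : 0 < F v - F w - k * `|w - v| by lra.
have [n _ Hn] := near_infty_natSinv_lt (PosNum D0).
have := usF n w (Sw n); have := Hn n (leqnn n); rewrite /=.
have := SF n.+1; rewrite /S/=.
have := mulr_ge0 (ltW k0) (normr_ge0 (v - us n.+1)).
have := mulr_ge0 (ltW k0) (normr_ge0 (w - v)); rewrite /=; move: (_^-1) => q; lra.
Qed.

(** * Mean value inequality and local inversion *)

Lemma differentiable_dist (R : realType) (V W : normedModType R) (f : V -> W) (x : V) :
  differentiable f x ->
  forall e : R, 0 < e -> exists2 d : R, 0 < d &
    forall h, `|h| < d -> `|f (x + h) - f x - 'd f x h| <= e * `|h|.
Proof.
move=> /diff_locallyP[_ /eqaddoP fx] e /fx /nbhs_normP [d d0 Hd].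
exists d => // h hd; have := Hd h; rewrite /ball_/= sub0r normrN => /(_ hd).
by rewrite /= !fctE opprD addrA [h + x]addrC.
Qed.

Lemma differentiable_of_dist (R : realType) (V W : normedModType R) (f : V -> W)
    (L : {linear V -> W}) (x : V) :
  continuous L ->
  (forall e : R, 0 < e -> exists2 d : R, 0 < d &
     forall h, `|h| < d -> `|f (x + h) - f x - L h| <= e * `|h|) ->
  differentiable f x /\ 'd f x = L :> (V -> W).
Proof.
move=> cL fx.
have fE : f \o shift x = cst (f x) + L +o_ 0 id.
  apply/eqaddoP => e /fx [d d0 Hd]; apply/nbhs_normP; exists d => // h.
  rewrite /ball_/= sub0r normrN => /Hd.
  by rewrite /= !fctE opprD addrA [h + x]addrC.
have dE := diff_unique cL fE.
by split => //; apply/diff_locallyP; rewrite dE.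
Qed.

Lemma linear_continuous_of_bound (R : realType) (V W : normedModType R)
    (L : {linear V -> W}) (C : R) :
  (forall h, `|L h| <= C * `|h|) -> continuous L.
Proof.
move=> LC x; apply/continuous_atP => e e0.
have C1 : 0 < `|C| + 1 by rewrite ltr_wpDl.
exists (e / (`|C| + 1)); first by rewrite divr_gt0.
move=> y; rewrite ltr_pdivlMr// => yx; rewrite -linearB.
apply: le_lt_trans yx; apply: le_trans (LC _) _; rewrite mulrC.
by apply: ler_wpM2l => //; apply: le_trans (ler_norm _) _; lra.
Qed.

(** Brings an arbitrary direction [h] into the range of a first-order estimate; [t <= 1] allows [t]
    to be used as a convex weight. *)
Lemma exists_small_scale (R : realType) (V : normedModType R) (h : V) (d : R) : 0 < d ->
  exists2 t : R, 0 < t <= 1 & `|t *: h| < d.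
Proof.
move=> d0; have h1 : 0 < `|h| + 1 by rewrite ltr_wpDl.
have q0 : 0 < d / (`|h| + 1) by rewrite divr_gt0.
pose t := Num.min 1 (d / (`|h| + 1)).
have t0 : 0 < t by rewrite lt_min ltr01.
have td : t * (`|h| + 1) <= d by rewrite -ler_pdivlMr// ge_min lexx orbT.
exists t; first by rewrite t0 ge_min lexx.
by rewrite normrZ gtr0_norm//; lra.
Qed.

Lemma le_of_forall_eps (R : realType) (x y c : R) : 0 <= c ->
  (forall e, 0 < e -> x <= y + e * c) -> x <= y.
Proof.
move=> c0 H; rewrite leNgt; apply/negP => yx.
have c1 : 0 < c + 1 by lra.
have /H : 0 < (x - y) / (c + 1) by rewrite divr_gt0// subr_gt0.
have : (x - y) / (c + 1) * (c + 1) = x - y by rewrite divfK// gt_eqF.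
have : 0 < (x - y) / (c + 1) by rewrite divr_gt0// subr_gt0.
lra.
Qed.

Lemma almost_min_diff (R : realType) (V : normedModType R) (F : V -> R) (k : R) (v : V) :
  differentiable F v -> (forall w, F v <= F w + k * `|w - v|) ->
  forall h, `|'d F v h| <= k * `|h|.
Proof.
move=> dF Fv.
suff main h : - (k * `|h|) <= 'd F v h.
  move=> h; rewrite ler_norml main /=.
  by have := main (- h); rewrite linearN normrN lerN2.
rewrite lerNl; apply: (@le_of_forall_eps _ _ _ `|h|) => // e e0.
have [d d0 Hd] := differentiable_dist _ _ _ _ _ dF e e0.
have [t /andP[t0 t1] th] := exists_small_scale _ _ h d d0.
have := Hd _ th; have := Fv (v + t *: h).
rewrite [v + _]addrC addrK linearZ /= normrZ gtr0_norm// ler_norml.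
move=> h1 /andP[_ h2]; rewrite -(ler_pM2l t0); rewrite /GRing.scale/= in h2; lra.
Qed.

(** A step [t *: h] in the Newton direction shrinks the residual [f v - b] by the factor 1 - t to
    first order, whereas almost minimality allows a gain of at most [k * t * |h|]. No derivative of
    the norm is taken. *)
Lemma almost_min_dist (R : realType) (V W : normedModType R) (f : V -> W)
    (b : W) (k : R) (v h : V) :
  differentiable f v -> (forall w, `|f v - b| <= `|f w - b| + k * `|w - v|) ->
  'd f v h = b - f v -> `|f v - b| <= k * `|h|.
Proof.
move=> df fv hE; apply: (@le_of_forall_eps _ _ _ `|h|) => // e e0.
have [d d0 Hd] := differentiable_dist _ _ _ _ _ df e e0.
have [t /andP[t0 t1] th] := exists_small_scale _ _ h d d0.
have := Hd _ th; have := fv (v + t *: h).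
rewrite [v + t *: h]addrC addrK linearZ /= hE normrZ gtr0_norm//.
set y := f (t *: h + v); move=> h1 h2.
have : `|y - b| <= `|y - f v - t *: (b - f v)| + (1 - t) * `|f v - b|.
  have t10 : 0 <= 1 - t by rewrite subr_ge0.
  rewrite -[X in X * `|_|](ger0_norm t10) -normrZ.
  have -> : y - b = y - f v - t *: (b - f v) + (1 - t) *: (f v - b).
    rewrite scalerBl scale1r -scalerN opprB.
    by rewrite [_ + t *: _ in RHS]addrC !subrKA.
  exact: ler_normD.
by move=> h3; rewrite -(ler_pM2l t0); lra.
Qed.

(** The increment estimate [Q] is additive by the triangle inequality and holds near each point by
    differentiability, so Cousin's lemma gives it on the whole segment. *)
Lemma mean_value_bound (R : realType) (V W : normedModType R) (f : V -> W)
    (A : {linear V -> W}) (x y : V) (K e : R) : 0 < e ->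
  (forall t, 0 <= t <= 1 -> differentiable f (x + t *: (y - x))) ->
  (forall t h, 0 <= t <= 1 -> `|'d f (x + t *: (y - x)) h - A h| <= K * `|h|) ->
  `|f y - f x - A (y - x)| <= (K + e) * `|y - x|.
Proof.
move=> e0 df dfA; set v := y - x.
pose Q s s' := `|f (x + s' *: v) - f (x + s *: v) - (s' - s) *: A v|
                 <= (K + e) * `|v| * (s' - s).
suff : Q 0 1.
  by rewrite /Q scale1r scale0r addr0 subr0 scale1r mulr1 /v [x + _]addrC subrK.
apply: (@cousin_unit_interval R Q) => [a b c _ _|t t01].
  rewrite /Q => ab bc.
  have -> : (K + e) * `|v| * (c - a) =
      (K + e) * `|v| * (c - b) + (K + e) * `|v| * (b - a) by ring.
  apply: le_trans (lerD bc ab); apply: le_trans (ler_normD _ _).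
  have -> : c - a = (c - b) + (b - a) by ring.
  by rewrite [in leLHS]scalerDl [in leLHS]opprD [in leRHS]addrACA subrKA.
have [d d0 Hd] := differentiable_dist _ _ _ _ _ (df t t01) e e0.
have v1 : 0 < `|v| + 1 by rewrite ltr_wpDl.
exists (d / (`|v| + 1)); first by rewrite divr_gt0.
have key s : `|s - t| < d / (`|v| + 1) ->
    `|f (x + s *: v) - f (x + t *: v) - (s - t) *: A v| <= (K + e) * `|v| * `|s - t|.
  rewrite ltr_pdivlMr// => sd.
  have /Hd : `|(s - t) *: v| < d.
    by rewrite normrZ (le_lt_trans _ sd)// ler_wpM2l//; lra.
  have -> : x + t *: v + (s - t) *: v = x + s *: v.
    by rewrite -addrA -scalerDl; congr (_ + _ *: _); ring.
  have := dfA t ((s - t) *: v) t01.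
  rewrite [A _]linearZ normrZ /=; set z := 'd f _ _ => h1 h2.
  apply: (@le_trans _ _ (e * (`|s - t| * `|v|) + K * (`|s - t| * `|v|))); last by lra.
  by apply: le_trans (lerD h2 h1); apply: le_trans (ler_normD _ _); rewrite subrKA.
move=> s s' s0 st ts' s'1 sd s'd.
have sd' : `|s - t| < d / (`|v| + 1) by rewrite ler0_norm ?subr_le0//; lra.
have s'd' : `|s' - t| < d / (`|v| + 1) by rewrite ger0_norm ?subr_ge0//; lra.
(* Since [s <= t <= s'], the distances of both endpoints to [t] add up to exactly [s' - s]. *)
have := lerD (key s' s'd') (key s sd').
rewrite (ger0_norm (x := s' - t)) ?subr_ge0// (ler0_norm (x := s - t)) ?subr_le0//.
rewrite -mulrDr; have -> : s' - t + - (s - t) = s' - s by ring.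
apply: le_trans; apply: le_trans (ler_normB _ _).
have -> : s' - s = (s' - t) - (s - t) by ring.
rewrite [(s' - t - _) *: _]scalerBl [in leLHS]opprD opprK.
rewrite [X in _ <= `|_ + X|]opprD opprK [X in _ <= `|_ + (X + _)|]opprB.
by rewrite [in leRHS]addrACA subrKA.
Qed.

Definition is_convex {R : realType} {V : normedModType R} (C : V -> Prop) :=
  forall p q (t : R), C p -> C q -> 0 <= t <= 1 -> C (p + t *: (q - p)).

Lemma is_convex_ball (R : realType) (V : normedModType R) (x : V) (r : R) :
  is_convex (fun p => `|p - x| < r).
Proof.
move=> p q t px qx /andP[t0 t1].
have -> : p + t *: (q - p) - x = t *: (q - x) + (1 - t) *: (p - x).
  by rewrite scalerBl scale1r addrCA -scalerBr [- (p - x)]opprB subrKA addrAC.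
apply: le_lt_trans (ler_normD _ _) _.
rewrite !normrZ (ger0_norm t0) ger0_norm ?subr_ge0//.
have := ler_wpM2l t0 (ltW qx).
have [t1'|t1'] := ltP t 1; last by have -> : t = 1; lra.
have : (1 - t) * `|p - x| < (1 - t) * r by rewrite ltr_pM2l// subr_gt0.
lra.
Qed.

Lemma le_norm_of_diff_close (R : realType) (V W : normedModType R)
    (f g : V -> W) (a e : R) (h : V) :
  a * `|h| <= `|f h| -> `|g h - f h| <= e * `|h| -> (a - e) * `|h| <= `|g h|.
Proof.
move=> fh gh; have : `|f h| <= `|g h - f h| + `|g h|.
  by rewrite -[leLHS]normrN; apply: le_trans (ler_normB _ _); rewrite addrC addKr.
lra.
Qed.

Lemma local_bijectivity (R : realType) (X B : completeNormedModType R) (f : X -> B)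
    (x0 : X) (a : R) :
  C1 f -> (forall x b, exists h, 'd f x h = b) -> 0 < a ->
  (forall h, a * `|h| <= `|'d f x0 h|) ->
  exists r : R, 0 < r /\
    (forall x y, `|x - x0| < r -> `|y - x0| < r ->
       a / 2 * `|x - y| <= `|f x - f y|) /\
    (forall b, `|b - f x0| < a / 4 * r -> exists2 x, `|x - x0| < r & f x = b).
Proof.
move=> [df cf] dfs a0 ha.
have a4 : 0 < a / 4 by lra.
(* On this ball the differential varies by at most [a / 4]. Another [a / 4] is lost in the mean
   value bound, which leaves [a / 2]; below, [a / 4] is also the Ekeland slope. *)
have [r r0 Hr] := cf x0 _ a4.
exists r; split=> //; split.
  move=> x y xr yr.
  have seg t : 0 <= t <= 1 -> `|y + t *: (x - y) - x0| < r by exact: is_convex_ball.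
  have := @mean_value_bound R X B f ('d f x0) y x (a / 4) _ a4 (fun t _ => df _)
    (fun t h t01 => Hr _ (seg t t01) h).
  have := @le_norm_of_diff_close R X B ('d f x0) (fun _ => f x - f y) a
    (a / 4 + a / 4) (x - y) (ha _).
  by move=> H /H; have -> : a - (a / 4 + a / 4) = a / 2 by lra.
move=> b bx0.
pose F x := `|f x - b|.
have cF : continuous F.
  move=> x; apply: (@continuous_comp _ _ _ (fun x => f x - b) (fun z => `|z|)).
    by apply: continuousB; [exact: differentiable_continuous | exact: cst_continuous].
  exact: norm_continuous.
have [v [vx0 Hv]] := @ekeland R X F (a / 4) x0 cF (fun x => normr_ge0 _) a4.
(* Ekeland's displacement times [a / 4] is at most the initial residual, which is below
   [a / 4 * r]. *)
have vr : `|v - x0| < r.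
  rewrite -(ltr_pM2l a4); apply: le_lt_trans bx0.
  by rewrite /F [`|f x0 - b|]distrC in vx0; have := normr_ge0 (f v - b); lra.
exists v => //.
have [h hE] := dfs v (b - f v).
(* Ekeland gives |f v - b| <= a/4 |h|, the lower bound gives 3a/4 |h| <= |f v - b|. *)
have := almost_min_dist _ _ _ _ _ _ _ _ (df v) Hv hE.
have := @le_norm_of_diff_close R X B ('d f x0) ('d f v) a _ h (ha h) (Hr v vr h).
rewrite hE [`|b - _|]distrC => h1 h2.
have h0 : a / 4 * `|h| <= 0 by have := mulr_ge0 (ltW a4) (normr_ge0 h); lra.
by apply/eqP; rewrite -subr_eq0 -normr_le0; exact: le_trans h0.
Qed.

(** * Properness and common domains of local sections *)

Lemma strictly_increasing_ge_id (phi : nat -> nat) :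
  {homo phi : m n / (m < n)%N >-> (m < n)%N} -> forall n, (n <= phi n)%N.
Proof. by move=> hphi; elim=> // n IH; apply: leq_ltn_trans IH (hphi _ _ _). Qed.

Lemma cvg_seq_subseq (R : realType) (V : normedModType R) (u : nat -> V) (l : V)
    (phi : nat -> nat) :
  {homo phi : m n / (m < n)%N >-> (m < n)%N} ->
  u @ \oo --> l -> (u \o phi) @ \oo --> l.
Proof.
move=> hphi /cvg_seq_distP ul; apply/cvg_seq_distP => e /ul [N HN].
by exists N => n Nn; apply: HN; apply: leq_trans Nn (strictly_increasing_ge_id _ hphi _).
Qed.

Lemma invS_eventually_small (R : realType) (e : R) : 0 < e ->
  exists N : nat, forall n, (N <= n)%N -> n.+1%:R^-1 < e.
Proof.
by move=> e0; have [N _ HN] := near_infty_natSinv_lt (PosNum e0); exists N => n /HN.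
Qed.

Lemma palais_smale_proper (R : realType) (X B : completeNormedModType R)
    (f : X -> B) (eta : B -> R) (y : B) (u : nat -> X) :
  (forall x, differentiable f x) -> (forall b, differentiable eta b) ->
  (forall b, 0 <= eta b) -> eta 0 = 0 ->
  palais_smale (fun x => eta (f x - y)) -> (f \o u) @ \oo --> y ->
  exists (phi : nat -> nat) (l : X),
    {homo phi : m n / (m < n)%N >-> (m < n)%N} /\ (u \o phi) @ \oo --> l.
Proof.
move=> df deta eta0 etaz PS /cvg_seq_distP fuy.
pose F x := eta (f x - y).
have dF x : differentiable F x.
  apply: (@differentiable_comp _ _ _ _ (fun x => f x - y) eta) => //.
  by apply: differentiableB => //; exact: differentiable_cst.
have cF : continuous F by move=> x; apply: differentiable_continuous.
have Fu e : 0 < e -> exists N : nat, forall n, (N <= n)%N -> F (u n) < e.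
  move=> e0; have /continuous_atP /(_ e e0) [d d0 Hd] := differentiable_continuous (deta 0).
  have [N HN] := fuy d d0; exists N => n /HN /= fd.
  by have := Hd (f (u n) - y); rewrite subr0 etaz subr0 ger0_norm// => /(_ fd).
(* The summand 1/(n+1) only keeps the slope positive when F (u n) = 0. *)
pose k n : R := Num.sqrt (F (u n)) + n.+1%:R^-1.
have k0 n : 0 < k n by rewrite ltr_wpDl ?sqrtr_ge0// invr_gt0.
have step n := @ekeland R X F (k n) (u n) cF (fun x => eta0 _) (k0 n).
pose v n := projT1 (cid (step n)).
have vu n : F (v n) + k n * `|v n - u n| <= F (u n) by rewrite /v; case: cid => ? [].
have vmin n w : F (v n) <= F w + k n * `|w - v n|.
  by rewrite /v; case: cid => ? [] ? H; exact: H.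
(* [F (u n)] is the square of its root and [k n] is at least that root, so dividing by [k n] leaves
   at most the root. *)
have vu_sqrt n : `|v n - u n| <= Num.sqrt (F (u n)).
  have : k n * `|v n - u n| <= F (u n).
    by have := eta0 (f (v n) - y); have := vu n; rewrite /F; lra.
  rewrite -{1}[F (u n)]sqr_sqrtr ?eta0// => H.
  rewrite -(ler_pM2l (k0 n)); apply: le_trans H _; rewrite expr2.
  by apply: ler_wpM2r; rewrite ?sqrtr_ge0// /k lerDl invr_ge0.
have sqrtFu e : 0 < e -> exists N : nat, forall n, (N <= n)%N -> Num.sqrt (F (u n)) < e.
  move=> e0; have [N HN] := Fu _ (exprn_gt0 2 e0); exists N => n /HN.
  by rewrite -ltr_sqrt ?exprn_gt0// sqrtr_sqr gtr0_norm.
have [phi [l [hphi vl]]] : exists (phi : nat -> nat) (l : X),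
    {homo phi : m n / (m < n)%N >-> (m < n)%N} /\ (v \o phi) @ \oo --> l.
  apply: PS.
    have [N HN] := Fu 1 ltr01.
    (* The tail is bounded by 1, and each earlier value by the sum of all of them. *)
    exists (1 + \sum_(i < N) F (u i)) => n.
    rewrite ger0_norm ?eta0//; apply: (@le_trans _ _ (F (u n))).
      by have := mulr_ge0 (ltW (k0 n)) (normr_ge0 (v n - u n)); have := vu n; rewrite /F; lra.
    have S0 (Q : pred 'I_N) : 0 <= \sum_(i < N | Q i) F (u i).
      by apply: sumr_ge0 => i _; exact: eta0.
    have [/HN|nN] := leqP N n; first by have := S0 predT; lra.
    by rewrite (bigD1 (Ordinal nN)) //=; have := S0 (fun i => i != Ordinal nN); lra.
  move=> e e0.
  have e2 : 0 < e / 2 by lra.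
  have [N1 H1] := sqrtFu _ e2; have [N2 H2] := invS_eventually_small _ _ e2.
  exists (maxn N1 N2) => n; rewrite geq_max => /andP[/H1 n1 /H2 n2] h.
  apply: le_trans (almost_min_diff _ _ _ _ _ (dF _) (vmin n) h) _.
  by apply: ler_wpM2r => //; move: n1 n2; rewrite /k; move: (n.+1%:R^-1) => q; lra.
exists phi, l; split => //; apply/cvg_seq_distP => e e0.
have e2 : 0 < e / 2 by lra.
have [N1 H1] := sqrtFu _ e2; have /cvg_seq_distP /(_ _ e2) [N2 H2] := vl.
exists (maxn N1 N2) => n; rewrite geq_max => /andP[n1 /H2 /= n2].
have := vu_sqrt (phi n).
have /H1 : (N1 <= phi n)%N by apply: leq_trans n1 (strictly_increasing_ge_id _ hphi _).
have : `|u (phi n) - l| <= `|v (phi n) - u (phi n)| + `|v (phi n) - l|.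
  by rewrite [`|v _ - u _|]distrC; apply: le_trans (ler_normD _ _); rewrite subrKA.
rewrite /=; lra.
Qed.

Lemma local_section (R : realType) (X B : completeNormedModType R) (f : X -> B)
    (x0 : X) (a : R) :
  C1 f -> (forall x b, exists h, 'd f x h = b) -> 0 < a ->
  (forall h, a * `|h| <= `|'d f x0 h|) ->
  exists (r e : R) (s : B -> X), [/\ 0 < r, 0 < e,
    forall p, `|p - f x0| < e -> [/\ f (s p) = p, `|s p - x0| < r & {for p, continuous s}] &
    forall x y, `|x - x0| < r -> `|y - x0| < r -> f x = f y -> x = y].
Proof.
move=> cf dfs a0 ha.
have [r [r0 [finj fsurj]]] := local_bijectivity _ _ _ _ _ _ cf dfs a0 ha.
pose e := a / 4 * r.
have e0 : 0 < e by rewrite mulr_gt0//; lra.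
have /choice [s Hs] p : exists x, `|p - f x0| < e -> f x = p /\ `|x - x0| < r.
  have [/fsurj[x xr fx]|_] := ltP `|p - f x0| e; last by exists 0.
  by exists x.
have a2 : 0 < a / 2 by lra.
exists r, e, s; split => //; last first.
  move=> x y xr yr fxy; have := finj x y xr yr.
  rewrite fxy subrr normr0 pmulr_rle0// normr_le0 subr_eq0.
  by move/eqP.
move=> p pe; have [fsp spr] := Hs p pe; split => //.
apply/continuous_atP => t t0.
(* The first bound keeps [q] in the ball; the second uses that [s] is Lipschitz there with constant
   [2 / a]. *)
exists (Num.min (e - `|p - f x0|) (a / 2 * t)).
  by rewrite lt_min mulr_gt0// subr_gt0 pe.
move=> q; rewrite lt_min => /andP[qp qt].
have qe : `|q - f x0| < e.
  have : `|q - f x0| <= `|q - p| + `|p - f x0|.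
    by apply: le_trans (ler_normD _ _); rewrite subrKA.
  lra.
have [fsq sqr] := Hs q qe.
rewrite -(ltr_pM2l a2); apply: le_lt_trans qt.
by rewrite -{2}fsq -{2}fsp; apply: finj.
Qed.

(** A compactness argument: points [u n] violating the claim at radius 1/(n+1) accumulate, by
    properness, at some [l] above [b]. The local section at [l] lives on a fixed ball and passes
    through late terms of the subsequence. *)
Lemma evenly_covered (R : realType) (X B : completeNormedModType R) (f : X -> B) (b : B) :
  C1 f -> (forall x b, exists h, 'd f x h = b) ->
  (forall x, exists2 a : R, 0 < a & forall h, a * `|h| <= `|'d f x h|) ->
  (forall u : nat -> X, (f \o u) @ \oo --> b -> exists (phi : nat -> nat) (l : X),
    {homo phi : m n / (m < n)%N >-> (m < n)%N} /\ (u \o phi) @ \oo --> l) ->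
  exists2 e : R, 0 < e & forall x, `|f x - b| < e -> exists s : B -> X,
    s (f x) = x /\ forall p, `|p - b| < e -> f (s p) = p /\ {for p, continuous s}.
Proof.
move=> cf dfs dfi fproper; apply: contrapT => nE.
pose bad (n : nat) x := `|f x - b| < n.+1%:R^-1 /\ ~ exists s : B -> X,
    s (f x) = x /\ forall p, `|p - b| < n.+1%:R^-1 -> f (s p) = p /\ {for p, continuous s}.
have /choice [u Hu] n : exists x, bad n x.
  apply: contrapT => nbad; apply: nE.
  exists n.+1%:R^-1; first by rewrite invr_gt0.
  by move=> x xn; apply: contrapT => ns; apply: nbad; exists x.
have fub : (f \o u) @ \oo --> b.
  apply/cvg_seq_distP => e e0; have [N HN] := invS_eventually_small _ _ e0.
  by exists N => n /HN; apply: lt_trans; case: (Hu n).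
have [phi [l [hphi ul]]] := fproper u fub.
have flb : f l = b.
  have fl : (f \o (u \o phi)) @ \oo --> f l.
    by apply: continuous_cvg => //; apply: differentiable_continuous; case: cf.
  apply: (cvg_unique _ fl) => //.
  exact: (cvg_seq_subseq _ _ (f \o u)).
have [a a0 ha] := dfi l.
have [r [e [s [r0 e0 Hs finj]]]] := local_section _ _ _ _ _ _ cf dfs a0 ha.
have /cvg_seq_distP /(_ r r0) [N1 H1] := ul.
have [N2 H2] := invS_eventually_small _ _ e0.
pose n := maxn N1 N2.
have [fn] := Hu (phi n); apply.
have ne : (phi n).+1%:R^-1 < e.
  by apply: H2; apply: leq_trans (leq_maxr _ _) (strictly_increasing_ge_id _ hphi _).
rewrite flb in Hs.
exists s; split; last first.
  by move=> p pn; have [] := Hs p (lt_trans pn ne).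
(* The section value and [u (phi n)] both lie in the injectivity ball around [l] and have the same
   image. *)
have [fs sr _] := Hs _ (lt_trans fn ne).
by apply: finj => //; apply: (H1 n (leq_maxl _ _)).
Qed.

(** * Continuation of sections along segments *)

Lemma line_uniformly_continuous (R : realType) (V : normedModType R) (x v : V) (d : R) :
  0 < d -> exists2 e : R, 0 < e &
    forall s t : R, `|s - t| < e -> `|x + s *: v - (x + t *: v)| < d.
Proof.
move=> d0; have v1 : 0 < `|v| + 1 by rewrite ltr_wpDl.
exists (d / (`|v| + 1)); first by rewrite divr_gt0.
move=> s t; rewrite ltr_pdivlMr// => st.
have -> : x + s *: v - (x + t *: v) = (s - t) *: v.
  by rewrite opprD addrACA subrr add0r scalerBl.
by rewrite normrZ (le_lt_trans _ st)// ler_wpM2l//; lra.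
Qed.

Lemma line_continuous (R : realType) (V : normedModType R) (x v : V) :
  continuous (fun t : R => x + t *: v).
Proof.
move=> t; apply/continuous_atP => d /(line_uniformly_continuous _ _ x v) [e e0 He].
by exists e => // s /He.
Qed.

Definition locally_injective {R : realType} {V W : normedModType R} (f : V -> W) :=
  forall x, exists2 r : R, 0 < r &
    forall y z, `|y - x| < r -> `|z - x| < r -> f y = f z -> y = z.

Lemma lift_unique (R : realType) (V W : normedModType R) (f : V -> W) (u v : R -> V) :
  locally_injective f ->
  (forall t : R, 0 <= t <= 1 -> {for t, continuous u}) ->
  (forall t : R, 0 <= t <= 1 -> {for t, continuous v}) ->
  (forall t : R, 0 <= t <= 1 -> f (u t) = f (v t)) ->
  u 0 = v 0 -> u 1 = v 1.
Proof.
move=> finj cu cv fuv; apply: (@locally_constant_unit_interval R (fun t => u t = v t)).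
move=> t t01.
have /continuous_atP cut := cu t t01; have /continuous_atP cvt := cv t t01.
have [uvt|/eqP uvt] := pselect (u t = v t).
  have [r r0 inj] := finj (u t).
  have [d1 d10 H1] := cut r r0; have [d2 d20 H2] := cvt r r0.
  exists (Num.min d1 d2); first by rewrite lt_min d10.
  move=> s s' _ s'01 _; rewrite lt_min => /andP[/H1 us /H2 vs] _.
  by apply: inj => //; [rewrite uvt | exact: fuv].
(* If the lifts differ at [t], both stay within half the gap nearby, so they cannot meet there and
   the implication is vacuous. *)
have q0 : 0 < `|u t - v t| / 2 by rewrite divr_gt0// normr_gt0 subr_eq0.
have [d1 d10 H1] := cut _ q0; have [d2 d20 H2] := cvt _ q0.
exists (Num.min d1 d2); first by rewrite lt_min d10.
move=> s s' _ _; rewrite lt_min => /andP[/H1 us /H2 vs] _ uvs.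
have : `|u t - v t| <= `|u s - u t| + `|v s - v t|.
  rewrite [`|u s - _|]distrC; apply: le_trans (ler_normD _ _).
  by rewrite uvs subrKA.
by move=> h; exfalso; clear uvs; lra.
Qed.

Lemma is_convexI (R : realType) (V : normedModType R) (C D : V -> Prop) :
  is_convex C -> is_convex D -> is_convex (fun p => C p /\ D p).
Proof. by move=> cC cD p q t [Cp Dp] [Cq Dq] t01; split; [exact: cC | exact: cD]. Qed.

(** Sections are total functions with arbitrary values off [C]. Continuity is in the whole space,
    not relative to [C], which suits open [C]. *)
Definition section_on {R : realType} {V W : normedModType R} (f : V -> W)
    (C : W -> Prop) (s : W -> V) :=
  forall p, C p -> f (s p) = p /\ {for p, continuous s}.

(** Convexity joins [p] to [q] inside [C]; along this segment both sections lift the same path. *)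
Lemma section_unique (R : realType) (V W : normedModType R) (f : V -> W)
    (C : W -> Prop) (s1 s2 : W -> V) (p q : W) :
  locally_injective f -> is_convex C -> section_on f C s1 -> section_on f C s2 ->
  C p -> s1 p = s2 p -> C q -> s1 q = s2 q.
Proof.
move=> finj cC H1 H2 Cp s12 Cq.
have Cl t : 0 <= t <= 1 -> C (p + t *: (q - p)) by exact: cC.
have cs (s : W -> V) t : section_on f C s -> 0 <= t <= 1 ->
    {for t, continuous (fun t : R => s (p + t *: (q - p)))}.
  move=> Hs t01; apply: (@continuous_comp _ _ _ (fun t : R => p + t *: (q - p)) s).
    exact: line_continuous.
  by have [] := Hs _ (Cl t t01).
have := @lift_unique R V W f _ _ finj (fun t => cs s1 t H1) (fun t => cs s2 t H2).
rewrite /= scale0r addr0 scale1r [p + _]addrC subrK; apply => // t t01.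
by rewrite (H1 _ (Cl t t01)).1 (H2 _ (Cl t t01)).1.
Qed.

(** The open [d]-neighbourhood of the segment from [y] to [y + s *: v], which is a ball when
    [s = 0]. *)
Definition tube {R : realType} {V : normedModType R} (y v : V) (s d : R) (p : V) :=
  exists2 t : R, 0 <= t <= s & `|p - (y + t *: v)| < d.

Lemma is_convex_tube (R : realType) (V : normedModType R) (y v : V) (s d : R) :
  is_convex (tube y v s d).
Proof.
move=> p q t [a /andP[a0 as_] pa] [b /andP[b0 bs] qb] t01.
exists (a + t * (b - a)).
  have /andP[t0 t1] := t01.
  have -> : a + t * (b - a) = (1 - t) * a + t * b by ring.
  have t1' : 0 <= 1 - t by lra.
  rewrite addr_ge0 ?mulr_ge0//=.
  have := ler_wpM2l t1' as_; have := ler_wpM2l t0 bs; lra.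
have := @is_convex_ball R V 0 d (p - (y + a *: v)) (q - (y + b *: v)) t.
rewrite !subr0 => /(_ pa qb t01); congr (`|_| < d).
have line z z' w w' :
    z - w + t *: (z' - w' - (z - w)) = z + t *: (z' - z) - (w + t *: (w' - w)).
  have -> : z' - w' - (z - w) = (z' - z) - (w' - w).
    by rewrite [- (z - w)]opprD opprK [in RHS]opprD opprK addrACA.
  by rewrite scalerBr opprD addrACA.
have -> : y + (a + t * (b - a)) *: v = y + a *: v + t *: (y + b *: v - (y + a *: v)).
  by rewrite [in RHS]opprD addrACA subrr add0r -scalerBl -addrA scalerA -scalerDl.
by rewrite line.
Qed.

Lemma tube_open (R : realType) (V : normedModType R) (y v : V) (s d : R) (p : V) :
  tube y v s d p -> exists2 e : R, 0 < e & forall q, `|q - p| < e -> tube y v s d q.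
Proof.
move=> [t ts pt]; exists (d - `|p - (y + t *: v)|); first by rewrite subr_gt0.
move=> q qp; exists t => //.
have : `|q - (y + t *: v)| <= `|q - p| + `|p - (y + t *: v)|.
  by apply: le_trans (ler_normD _ _); rewrite subrKA.
lra.
Qed.

Lemma continuous_at_eq_near (R : realType) (V W : normedModType R) (f g : V -> W)
    (x : V) (e : R) : 0 < e -> (forall y, `|y - x| < e -> f y = g y) ->
  {for x, continuous f} -> {for x, continuous g}.
Proof.
move=> e0 fg /continuous_atP cf; apply/continuous_atP => d /cf [r r0 Hr].
exists (Num.min r e); first by rewrite lt_min r0.
move=> y; rewrite lt_min => /andP[/Hr yr ye].
by rewrite -fg// -fg// subrr normr0.
Qed.

(* Weaker than the topological notion: only sections over a common ball through
   each point above it, with no local triviality. *)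
Definition covering_map {R : realType} {V W : normedModType R} (f : V -> W) :=
  forall b, exists2 e : R, 0 < e & forall x, `|f x - b| < e -> exists s : W -> V,
    s (f x) = x /\ section_on f (fun p => `|p - b| < e) s.

(** The section is prolonged along the axis by gluing it to one over a ball. The overlap of tube and
    ball is convex, so agreement at one point forces agreement throughout. *)
Lemma tube_section (R : realType) (V W : normedModType R) (f : V -> W) (x : V) (v : W) :
  locally_injective f -> covering_map f ->
  exists (d : R) (s : W -> V), [/\ 0 < d, s (f x) = x & section_on f (tube (f x) v 1 d) s].
Proof.
move=> finj fcov; set y := f x.
pose P a := exists (d : R) (s : W -> V),
  [/\ 0 < d, s y = x & section_on f (tube y v a d) s].
apply: (@locally_constant_unit_interval R P); last first.
  have [e e0 He] := fcov y.
  have [|s [sx Hs]] := He x; first by rewrite subrr normr0.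
  exists e, s; split => // p [t].
  rewrite -eq_le => /eqP <-; rewrite scale0r addr0; exact: Hs.
move=> t t01.
have [e e0 He] := fcov (y + t *: v).
(* One half of [e] is for the distance to the axis, the other for the displacement along it. *)
have e2 : 0 < e / 2 by lra.
have [r r0 Hr] := line_uniformly_continuous _ _ y v _ e2.
exists r => // a b a01 b01 ar br [d [s [d0 sy Hs]]].
have [ba|ab] := leP b a.
  exists d, s; split => // p [c /andP[c0 cb] pc]; apply: Hs.
  by exists c => //; rewrite c0 (le_trans cb ba).
have Ta : tube y v a d (y + a *: v).
  by exists a; [lra | rewrite subrr normr0].
have fa := (Hs _ Ta).1.
have [|s' [s'a Hs']] := He (s (y + a *: v)).
  by rewrite fa; have := Hr a t ar; lra.
rewrite fa in s'a.
have agree p : tube y v a d p -> `|p - (y + t *: v)| < e -> s p = s' p.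
  move=> Tp pe; apply: (@section_unique R V W f _ s s' (y + a *: v) p finj
    (@is_convexI R W _ _ (@is_convex_tube R W y v a d)
       (@is_convex_ball R W (y + t *: v) e))) => //.
  - by move=> q [Tq _]; exact: Hs.
  - by move=> q [_ qe]; exact: Hs'.
  - by split=> //; have := Hr a t ar; lra.
pose g p := if `[< tube y v a d p >] then s p else s' p.
have gs p : tube y v a d p -> g p = s p by move=> Tp; rewrite /g asboolT.
have gs' p : `|p - (y + t *: v)| < e -> g p = s' p.
  move=> pe; rewrite /g; case: asboolP => // Tp; exact: agree.
exists (Num.min d (e / 2)), g; split; first by rewrite lt_min d0.
  by rewrite gs//; exists 0; [lra | rewrite scale0r addr0 subrr normr0].
move=> p [c /andP[c0 cb]]; rewrite lt_min => /andP[pd pe2].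
(* Axis parameters up to [a] fall in the old tube; those between [a] and [b] are close to [t], so
   [p] lies in the ball. *)
have [ca|ac] := leP c a.
  have Tp : tube y v a d p by exists c => //; rewrite c0.
  have [fsp csp] := Hs p Tp; rewrite gs//; split => //.
  have [q q0 Hq] := tube_open _ _ _ _ _ _ _ Tp.
  by apply: (continuous_at_eq_near _ _ _ s g p q) => // z /Hq /gs.
have pe : `|p - (y + t *: v)| < e.
  have ct : `|c - t| < r by move: ar br; rewrite !ltr_norml; lra.
  have : `|p - (y + t *: v)| <= `|p - (y + c *: v)| + `|y + c *: v - (y + t *: v)|.
    by apply: le_trans (ler_normD _ _); rewrite subrKA.
  have := Hr c t ct; lra.
have [fsp csp] := Hs' p pe; rewrite gs'//; split => //.
apply: (continuous_at_eq_near _ _ _ s' g p (e - `|p - (y + t *: v)|)) => //.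
  by rewrite subr_gt0.
move=> z zp; rewrite gs'//.
have : `|z - (y + t *: v)| <= `|z - p| + `|p - (y + t *: v)|.
  by apply: le_trans (ler_normD _ _); rewrite subrKA.
lra.
Qed.

(** [g b] is the end value of the section continued from [f 0] to [b], starting at the point 0. *)
Lemma covering_map_inverse (R : realType) (V W : normedModType R) (f : V -> W) :
  continuous f -> locally_injective f -> covering_map f ->
  exists g : W -> V, [/\ cancel f g, cancel g f & continuous g].
Proof.
move=> cf finj fcov; set y := f 0.
have /choice [d /choice [s Hs]] (b : W) := tube_section R V W f 0 (b - y) finj fcov.
have endT b e : 0 < e -> tube y (b - y) 1 e b.
  by move=> e0; exists 1; [lra | rewrite scale1r [y + _]addrC subrK subrr normr0].
have startT b e : 0 < e -> tube y (b - y) 1 e y.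
  by move=> e0; exists 0; [lra | rewrite scale0r addr0 subrr normr0].
pose g b := s b b.
have fg : cancel g f.
  by move=> b; have [d0 _ Hb] := Hs b; have [] := Hb b (endT b (d b) d0).
have cg : continuous g.
  move=> b; have [d0 sy Hb] := Hs b.
  have [q q0 Hq] := tube_open _ _ _ _ _ _ _ (endT b (d b) d0).
  have cb : {for b, continuous (s b)} by have [] := Hb b (endT b (d b) d0).
  (* The tubes towards [b] and towards [c] meet in a convex set containing [y] and [c], and both
     sections take the value 0 at [y]. *)
  suff H c : `|c - b| < q -> s b c = g c.
    exact: continuous_at_eq_near _ _ _ _ _ _ _ q0 H cb.
  move=> /Hq Tc; have [d0' sy' Hc] := Hs c; rewrite /g.
  apply: (@section_unique R V W f _ (s b) (s c) y c finj
    (@is_convexI R W _ _ (@is_convex_tube R W y (b - y) 1 (d b))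
       (@is_convex_tube R W y (c - y) 1 (d c)))).
  - by move=> p [Tp _]; exact: Hb.
  - by move=> p [_ Tp]; exact: Hc.
  - by split; exact: startT.
  - by rewrite sy sy'.
  - by split => //; exact: endT.
(* On the segment from 0 to [x], the identity and [g \o f] give two lifts of the same path with
   common start 0. *)
exists g; split => // x.
have cl : continuous (fun t : R => 0 + t *: x) by exact: line_continuous.
have := @lift_unique R V W f (fun t => g (f (0 + t *: x))) (fun t => 0 + t *: x) finj.
rewrite /= !scale1r !scale0r !add0r; apply.
- move=> t _; apply: (@continuous_comp _ _ _ (fun t : R => 0 + t *: x) (fun x => g (f x))).
    exact: cl.
  by apply: continuous_comp; [exact: cf | exact: cg].
- by move=> t _; exact: cl.
- by move=> t _; rewrite fg.
- by have [d0 sy _] := Hs y; exact: sy.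
Qed.

(** * The inverse is of class C1 *)

Lemma bounded_below_right_inverse (R : realType) (V W : normedModType R)
    (A : {linear V -> W}) (a : R) :
  0 < a -> (forall h, a * `|h| <= `|A h|) -> (forall b, exists h, A h = b) ->
  exists L : {linear W -> V}, (forall k, A (L k) = k) /\ forall k, `|L k| <= a^-1 * `|k|.
Proof.
move=> a0 ha /choice [L0 AL].
have inj h : A h = 0 -> h = 0.
  move=> Ah; have := ha h; rewrite Ah normr0 pmulr_rle0// normr_le0.
  by move/eqP.
have Llin : linear L0.
  (* The chosen preimages are unique by the lower bound, hence depend linearly on the target. *)
  move=> c k l; apply/eqP; rewrite -subr_eq0; apply/eqP/inj.
  by rewrite linearB linearP !AL subrr.
pose L : {linear W -> V} := HB.pack L0 (GRing.isLinear.Build R W V *:%R L0 Llin).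
exists L; split => // k.
by rewrite -(ler_pM2l a0) mulVKf ?gt_eqF//; have := ha (L k); rewrite [A _]AL.
Qed.

Lemma inverse_differentiable (R : realType) (V W : normedModType R)
    (f : V -> W) (g : W -> V) (b : W) (a : R) :
  differentiable f (g b) -> cancel g f -> {for b, continuous g} -> 0 < a ->
  (forall h, a * `|h| <= `|'d f (g b) h|) -> (forall k, exists h, 'd f (g b) h = k) ->
  differentiable g b /\ forall k, 'd f (g b) ('d g b k) = k.
Proof.
move=> df fg /continuous_atP cg a0 ha hs.
have [L [AL Lb]] := bounded_below_right_inverse _ _ _ _ _ a0 ha hs.
have [] := @differentiable_of_dist R W V g L b (@linear_continuous_of_bound R W V L _ Lb).
  move=> e e0.
  (* The bound [a / 2] absorbs the error and gives [a * |w| <= 2 * |k|]; the second then makes the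
     error [a * |w - L k|] at most [e * a * |k|]. *)
  pose e' := Num.min (a / 2) (e * (a * a / 2)).
  have e'0 : 0 < e' by rewrite lt_min !mulr_gt0 ?invr_gt0.
  have [d d0 Hd] := differentiable_dist _ _ _ _ _ df e' e'0.
  have [r r0 Hr] := cg d d0.
  exists r => // k kr.
  set w := g (b + k) - g b.
  have wd : `|w| < d by apply: Hr; rewrite addrC addKr.
  have gw : g b + w = g (b + k) by rewrite /w addrC subrK.
  have := Hd w wd; rewrite gw !fg [b + k]addrC addrK => kw.
  have e'1 : e' <= a / 2 by rewrite ge_min lexx.
  have e'2 : e' <= e * (a * a / 2) by rewrite ge_min lexx orbT.
  have : a * `|w - L k| <= e' * `|w|.
    by apply: le_trans (ha _) _; rewrite linearB AL distrC.
  have : `|w| <= `|w - L k| + `|L k|.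
    by apply: le_trans (ler_normD _ _); rewrite (subrK (L k) w).
  have : a * `|L k| <= `|k| by have := ha (L k); rewrite AL.
  move: (`|w - L k|) (`|L k|) (normr_ge0 w) (normr_ge0 (L k)) => p q w0 q0 aq wpq apw.
  have h1 : e' * `|w| <= a / 2 * `|w| by rewrite ler_wpM2r.
  have h2 : a * `|w| <= a * (p + q) by rewrite ler_wpM2l// ltW.
  have h3 : a * `|w| <= 2 * `|k| by lra.
  have h4 : e' * `|w| <= e * (a * a / 2) * `|w| by rewrite ler_wpM2r.
  have h5 : e * a / 2 * (a * `|w|) <= e * a / 2 * (2 * `|k|).
    by rewrite ler_wpM2l// ltW// divr_gt0// mulr_gt0.
  by rewrite -(ler_pM2l a0); lra.
by move=> dg dgL; split => // k; rewrite dgL.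
Qed.

Lemma inverse_C1 (R : realType) (V W : normedModType R) (f : V -> W) (g : W -> V) :
  C1 f -> cancel g f -> continuous g ->
  (forall x, (forall b, exists h, 'd f x h = b) /\
     exists2 a : R, 0 < a & forall h, a * `|h| <= `|'d f x h|) -> C1 g.
Proof.
move=> [df cdf] fg cg hf.
have dg b : differentiable g b /\ forall k, 'd f (g b) ('d g b k) = k.
  have [hs [a a0 ha]] := hf (g b).
  exact: (@inverse_differentiable R V W f g b a (df _) fg (cg b) a0 ha hs).
split=> [b|b e e0]; first by have [] := dg b.
have [_ [a a0 ha]] := hf (g b).
pose e' := Num.min (a / 2) (e * (a * a / 2)).
have e'0 : 0 < e' by rewrite lt_min !mulr_gt0 ?invr_gt0.
have e'1 : e' <= a / 2 by rewrite ge_min lexx.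
have e'2 : e' <= e * (a * a / 2) by rewrite ge_min lexx orbT.
have [d d0 Hd] := cdf (g b) e' e'0.
have /continuous_atP /(_ d d0) [r r0 Hr] := cg b.
exists r => // c /Hr cb k.
set l := 'd g b k; set l' := 'd g c k.
have fl : 'd f (g b) l = k by exact: (dg b).2.
have fl' : 'd f (g c) l' = k by exact: (dg c).2.
have h1 : (a - e') * `|l' - l| <= `|'d f (g c) (l' - l)|.
  by apply: le_norm_of_diff_close (ha _) _; exact: Hd.
(* Both differentials send their vector to [k], so this is the difference of the two differentials
   of [f] applied to [l]. *)
have h2 : `|'d f (g c) (l' - l)| <= e' * `|l|.
  by rewrite linearB fl' -{1}fl distrC; exact: Hd.
have h3 : a * `|l| <= `|k| by rewrite -fl.
have h4 : a / 2 * `|l' - l| <= (a - e') * `|l' - l|.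
  by rewrite ler_wpM2r//; lra.
have h5 : e' * `|l| <= e * (a * a / 2) * `|l| by rewrite ler_wpM2r.
have h6 : e * a / 2 * (a * `|l|) <= e * a / 2 * `|k|.
  by rewrite ler_wpM2l// ltW// divr_gt0// mulr_gt0.
have a2 : 0 < a / 2 by lra.
by rewrite -(ler_pM2l a2); lra.
Qed.

Theorem theorem5 (R : realType) (X B : completeNormedModType R)
  (f : X -> B) (eta : B -> R) :
  C1 f -> C1 eta ->
  (forall x, 0 <= eta x) ->
  (forall x, eta x = 0 <-> x = 0) ->
  (forall x, ('d eta x = 0 :> (B -> R)) <-> x = 0) ->
  (forall y : B, palais_smale (fun x : X => eta (f x - y))) ->
  (forall x : X, (forall b : B, exists h : X, 'd f x h = b) /\
     exists2 a : R, 0 < a & forall h : X, a * `|h| <= `|'d f x h|) ->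
  (exists (a c M : R), [/\ 0 < a, 0 < c, 0 < M &
     forall x : B, `|x| <= M -> c * (`|x| `^ a) <= eta x]) ->
  diffeomorphism f.
Proof.
move=> cf ceta eta_ge0 eta_eq0 _ PS hf _.
have dfs x := (hf x).1; have dfi x := (hf x).2.
have finj : locally_injective f.
  move=> x; have [a a0 ha] := dfi x.
  have [r [e [s [r0 _ _ inj]]]] := local_section _ _ _ _ _ _ cf dfs a0 ha.
  by exists r.
have fcov : covering_map f.
  move=> b; apply: evenly_covered => // u.
  exact: (palais_smale_proper _ _ _ _ _ _ _ cf.1 ceta.1 eta_ge0 ((eta_eq0 0).2 erefl) (PS b)).
have [g [gf fg cg]] := covering_map_inverse _ _ _ _
  (fun x => differentiable_continuous (cf.1 x)) finj fcov.
split=> //; exists g; split=> //; split => //.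
exact: inverse_C1 cf fg cg hf.
Qed.
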